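(* Let $\mathbb{K}$ be a field, let $0 \le \ell < k$ be integers, let $n \ge k$ be an integer, and let $X$ be a simplicial complex with $\Delta_{n-1}^{(k-1)} \subset X \subset \Delta_{n-1}$. Suppose that $\lambda_{\ell,k-\ell-2}(X)=\sum_{\tau \in X(\ell)} \tilde{\beta}_{k-\ell-2}(\mathrm{lk}(X,\tau))=0$. Then $$\tilde{\beta}_{k-1}(X) \le B_{n,k,\ell}=\frac{\binom{n-1}{\ell}\binom{n-\ell-2}{k-\ell}}{\binom{k+1}{\ell+1}}.$$
   Context: Simplicial complexes are finite abstract simplicial complexes containing the empty simplex (of dimension $-1$). $\Delta_{n-1}$ is the full simplex on the vertex set $[n]=\{0,\ldots,n-1\}$, and $Y^{(j)}$ denotes the $j$-dimensional skeleton of a complex $Y$. $X(j)$ is the set of $j$-dimensional simplices of $X$. For $\tau\in X$, the link is $\mathrm{lk}(X,\tau)=\{\sigma\in X: \sigma\cup\tau\in X,\ \sigma\cap\tau=\emptyset\}$. $\tilde{\beta}_j(Y)=\dim_{\mathbb{K}}\tilde{H}_j(Y;\mathbb{K})$ is the reduced Betti number over the fixed field $\mathbb{K}$; in particular $\tilde\beta_{-1}(\{\emptyset\})=1$ and $\tilde\beta_{-1}(Y)=0$ if $Y$ has a vertex. $\subset$ allows equality. Binomial coefficients are $\binom{a}{b}=a(a-1)\cdots(a-b+1)/b!$ for integers $a$ and $b \ge 0$. *)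

(* Defs.v *)
From HB Require Import structures.
From mathcomp Require Import all_boot all_order all_algebra.

Set Implicit Arguments.
Unset Strict Implicit.
Unset Printing Implicit Defensive.

Import Order.TTheory GRing.Theory Num.Theory.
Local Open Scope ring_scope.

(* Complexes live on the ordered vertex set 'I_n, but need not use all of it:
   the link of a face is again a set of subsets of 'I_n. *)
Definition is_complex n (X : {set {set 'I_n}}) : Prop :=
  set0 \in X /\
  forall s t : {set 'I_n}, s \in X -> t \subset s -> t \in X.

Definition dim n (s : {set 'I_n}) : int := #|s|%:Z - 1.

Definition full_simplex n : {set {set 'I_n}} := powerset [set: 'I_n].

Definition skeleton n (Y : {set {set 'I_n}}) (j : int) : {set {set 'I_n}} :=
  [set s in Y | dim s <= j].

Definition faces n (X : {set {set 'I_n}}) (j : int) : {set {set 'I_n}} :=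
  [set s in X | dim s == j].

Definition link n (X : {set {set 'I_n}}) (t : {set 'I_n}) : {set {set 'I_n}} :=
  [set s in X | (s :|: t \in X) && (s :&: t == set0)].

(* Chains of all degrees and all complexes on 'I_n sit in one ambient space,
   with basis the subsets of 'I_n, each oriented by the order of 'I_n. *)
Notation chain K n := {ffun {set 'I_n} -> K^o}.

Definition elem (K : fieldType) n (s : {set 'I_n}) : chain K n :=
  [ffun t => (t == s)%:R].

(* The position of v in s, counted from 0 in increasing order. *)
Definition pos n (s : {set 'I_n}) (v : 'I_n) : nat :=
  #|[set u in s | (u < v)%N]|.

(* The augmented differential: a vertex is sent to the empty simplex, and the
   empty simplex to 0. *)
Definition bd (K : fieldType) n (c : chain K n) : chain K n :=
  \sum_(s : {set 'I_n})
    c s *: \sum_(v in s) (-1) ^+ pos s v *: elem K (s :\ v).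

Fact bd_is_linear (K : fieldType) n : linear (@bd K n).
Proof.
move=> a c c'; rewrite /bd scaler_sumr -big_split /=; apply: eq_bigr => s _.
by rewrite !ffunE scalerDl scalerA.
Qed.

HB.instance Definition _ (K : fieldType) n :=
  GRing.isLinear.Build K (chain K n) (chain K n) *:%R (@bd K n)
    (@bd_is_linear K n).

Definition chains (K : fieldType) n (X : {set {set 'I_n}}) (j : int) :
    {vspace chain K n} :=
  <<[seq elem K s | s in faces X j]>>%VS.

Definition cycles (K : fieldType) n (X : {set {set 'I_n}}) (j : int) :
    {vspace chain K n} :=
  (chains K X j :&: lker (linfun (@bd K n)))%VS.

Definition boundaries (K : fieldType) n (X : {set {set 'I_n}}) (j : int) :
    {vspace chain K n} :=
  (linfun (@bd K n) @: chains K X (j + 1))%VS.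

Lemma bd_elem (K : fieldType) n (s : {set 'I_n}) :
  bd (elem K s) = \sum_(v in s) (-1) ^+ pos s v *: elem K (s :\ v).
Proof.
rewrite /bd (bigD1 s) //= [X in _ + X]big1 ?addr0; last first.
  by move=> t /negPf nts; rewrite ffunE nts scale0r.
by rewrite {1}/elem ffunE eqxx scale1r.
Qed.

Lemma pos_D1 n (s : {set 'I_n}) (v w : 'I_n) : v \in s ->
  pos s w = ((v < w) + pos (s :\ v) w)%N.
Proof.
move=> vs; rewrite /pos (cardsD1 v) !inE vs /=; congr (_ + #|pred_of_set _|)%N.
by apply/setP => u; rewrite !inE andbA.
Qed.

Lemma bd_bd_elem (K : fieldType) n (s : {set 'I_n}) : bd (bd (elem K s)) = 0.
Proof.
pose F v w : chain K n :=
  (-1) ^+ (pos s v + pos (s :\ v) w) *: elem K (s :\ v :\ w).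
have -> : bd (bd (elem K s)) = \sum_(v in s) \sum_(w in s | w != v) F v w.
  rewrite bd_elem linear_sum; apply: eq_bigr => v _.
  rewrite linearZ /= bd_elem scaler_sumr; apply: eq_big => [w|w _].
    by rewrite !inE andbC.
  by rewrite scalerA -exprD.
have -> : \sum_(v in s) \sum_(w in s | w != v) F v w =
  \sum_(v in s) \sum_(w in s | (w < v)%N) F v w +
  \sum_(v in s) \sum_(w in s | (v < w)%N) F v w.
  rewrite -big_split /=; apply: eq_bigr => v _.
  rewrite (bigID (fun w : 'I_n => (w < v)%N)) /=; congr (_ + _);
    apply: eq_bigl => w; rewrite -andbA; congr (_ && _);
    rewrite -val_eqE /=; by case: ltngtP.
rewrite [X in _ + X](exchange_big_dep (mem s)) /=; last by move=> ? ? _ /andP[].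
rewrite -big_split big1 //= => v vs.
rewrite [X in _ + X](eq_bigl (fun w => (w \in s) && (w < v)%N)); last first.
  by move=> w; rewrite vs.
rewrite -big_split big1 //= => w /andP[ws wv].
have E : s :\ w :\ v = s :\ v :\ w by apply/setP => u; rewrite !inE andbCA.
rewrite /F E.
rewrite -scalerDl (pos_D1 v ws) (pos_D1 w vs) wv [(v < w)%N]ltnNge ltnW //=.
by rewrite add0n add1n addSn exprS addnC mulN1r addNr scale0r.
Qed.

(* The degree-j boundaries are cycles, so that the difference of dimensions
   below is the dimension of the quotient. *)
Lemma boundaries_sub_cycles (K : fieldType) n (X : {set {set 'I_n}}) (j : int) :
  is_complex X -> (boundaries K X j <= cycles K X j)%VS.
Proof.
move=> [_ Xdown]; rewrite /boundaries /chains limg_span; apply/span_subvP => c.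
case/mapP => _ /imageP[s sX ->] ->; rewrite lfunE /= memv_cap; apply/andP; split.
  rewrite bd_elem; apply: rpred_sum => v vs; apply/rpredZ/memv_span/image_f.
  move: sX; rewrite !inE => /andP[sX].
  rewrite (Xdown s) ?subsetDl //= /dim (cardsD1 v s) vs.
  by rewrite PoszD addrAC subrr add0r => /eqP ->; rewrite addrK.
by rewrite memv_ker lfunE /= bd_bd_elem.
Qed.

Definition betti (K : fieldType) n (X : {set {set 'I_n}}) (j : int) : nat :=
  (\dim (cycles K X j) - \dim (boundaries K X j))%N.

Definition lambda (K : fieldType) n (X : {set {set 'I_n}}) (i j : int) : nat :=
  (\sum_(t in faces X i) betti K (link X t) j)%N.

(* Binomial coefficients with an integer, possibly negative, upper argument. *)
Definition binz (a : int) (b : nat) : rat :=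
  (\prod_(i < b) (a - i%:Z)%:~R) / (b`!)%:R.

Definition bound (n k l : nat) : rat :=
  binz (n%:Z - 1) l * binz (n%:Z - l%:Z - 2) (k - l)%N
  / binz (k%:Z + 1) l.+1.

(* Main.v *)
(* The projection of chains onto the simplices containing a face t is, up to
   signs, a chain map onto the chains of the link of t.  Choose a set A of
   k-simplices of X whose boundaries form a basis of B_{k-1}(X).  Projecting this
   basis kills the simplices not containing t, so if #|t| = l + 1 then, as the
   homology of the link vanishes, at least
     dim Z_{k-l-2}(lk(X,t)) = C(n-l-2, k-l-1)
   elements of A contain t.  Summing over all t gives
     C(k+1, l+1) #|A| >= C(n, l+1) C(n-l-2, k-l-1),
   and the Betti number is at most C(n-1, k) - #|A|. *)
Require Import Defs.
From HB Require Import structures.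
From mathcomp Require Import all_boot all_order all_algebra.
From mathcomp Require Import ring zify.

Set Implicit Arguments.
Unset Strict Implicit.
Unset Printing Implicit Defensive.

Import Order.TTheory GRing.Theory Num.Theory.
Local Open Scope ring_scope.

(** * Coordinates of chains and of the differential *)

Section Chains.
Variables (K : fieldType) (n : nat).
Implicit Types (X Y : {set {set 'I_n}}) (s t V : {set 'I_n}) (c : chain K n).

(** Trades the integer dimension for a cardinality; [m = 0] is the empty simplex. *)
Lemma in_faces X (j : int) m s : j + 1 = m%:Z ->
  (s \in faces X j) = (s \in X) && (#|s| == m).
Proof.
move=> jm; have -> : j = m%:Z - 1 by rewrite -jm addrK.
by rewrite inE /dim (inj_eq (addIr _)) eqz_nat.
Qed.

Lemma chain_sum_elem c : c = \sum_s c s *: elem K s.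
Proof.
apply/ffunP => t; rewrite sum_ffunE (bigD1 t) //= big1 => [|s /negPf nst].
  by rewrite addr0 !ffunE eqxx [RHS]mulr1.
by rewrite !ffunE eq_sym nst [LHS]mulr0.
Qed.

Lemma mem_chains X (j : int) c :
  reflect (forall s, s \notin faces X j -> c s = 0) (c \in chains K X j).
Proof.
apply: (iffP idP) => [|c0].
  rewrite /chains; case/(@coord_span _ _ _ (in_tuple _)) => -> s sX.
  rewrite sum_ffunE big1 // => i _.
  have /mapP[t] := mem_nth 0 (ltn_ord i); rewrite mem_enum => tX ->.
  rewrite !ffunE; case: eqP => [st|_]; last by rewrite [LHS]mulr0.
  by rewrite st tX in sX.
rewrite [c]chain_sum_elem; apply: rpred_sum => s _.
case: (boolP (s \in faces X j)) => sX; last by rewrite c0 // scale0r mem0v.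
by apply/rpredZ/memv_span/image_f.
Qed.

Lemma dim_chains X (j : int) : \dim (chains K X j) = #|faces X j|.
Proof.
suff /eqP -> : free [seq elem K s | s in faces X j] by rewrite size_image.
apply/freeP => a /ffunP a0 i; have := a0 (enum_val i).
rewrite sum_ffunE (bigD1 i) //= big1 => [|i' ii'].
  by rewrite addr0 !ffunE nth_image ffunE eqxx [_ *: _]mulr1.
by rewrite !ffunE nth_image ffunE (inj_eq enum_val_inj) eq_sym (negPf ii') [LHS]mulr0.
Qed.

(** Transposing the sum gathers at [t] the simplices with one more vertex, so that later identities
    can be checked coefficientwise. *)
Lemma bdE c t :
  bd c t = \sum_(u | u \notin t) (-1) ^+ pos (u |: t) u * c (u |: t).
Proof.
rewrite /bd sum_ffunE.
under eq_bigr => s _.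
  rewrite !ffunE sum_ffunE scaler_sumr.
  under eq_bigr => u us do rewrite !ffunE.
  over.
rewrite (exchange_big_dep predT) //= big_mkcond /= [RHS]big_mkcond /=.
apply: eq_bigr => u _; case: ifP => [ut|/negbFE ut].
  rewrite (bigD1 (u |: t)) ?setU11 //= setU1K // eqxx big1 => [|s /andP[us nst]].
    by rewrite addr0 [_ *: 1%R]mulr1 [LHS]mulrC.
  case: eqP => [ts|_]; last by rewrite [_ *: 0%R]mulr0 [LHS]mulr0.
  by rewrite ts setD1K // eqxx in nst.
rewrite big1 // => s us; case: eqP => [ts|_]; last by rewrite [_ *: 0%R]mulr0 [LHS]mulr0.
by rewrite ts !inE eqxx in ut.
Qed.

Lemma bd_bd c : bd (bd c) = 0.
Proof.
rewrite [in LHS](chain_sum_elem c) [bd (\sum_s (_ *: elem _ s))]linear_sum linear_sum.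
rewrite big1 //= => s _; rewrite [bd (_ *: elem _ _)]linearZ.
by rewrite linearZ /= bd_bd_elem scaler0.
Qed.

Lemma mem_cycles X (j : int) c :
  (c \in cycles K X j) = (c \in chains K X j) && (bd c == 0).
Proof. by rewrite memv_cap memv_ker lfunE. Qed.

(** * Dimensions of cycle spaces *)

(* A cycle is determined by its image under [avoid v], and the boundary of the
   cone over [s] with apex [v] is sent to [elem K s] up to sign. *)
Definition avoid (v : 'I_n) c : chain K n :=
  [ffun s : {set 'I_n} => (v \notin s)%:R * c s].

Fact avoid_is_linear v : linear (avoid v).
Proof.
move=> a c c'; apply/ffunP => s; rewrite !ffunE mulrDr; congr (_ + _).
exact: mulrCA.
Qed.

HB.instance Definition _ v :=
  GRing.isLinear.Build K (chain K n) (chain K n) *:%R (avoid v)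
    (avoid_is_linear v).

Lemma card_draws_avoid V v m : v \in V ->
  #|[set s : {set 'I_n} | s \subset V :\ v & #|s| == m]| = 'C(#|V|.-1, m).
Proof. by move=> vV; rewrite cards_draws (cardsD1 v V) vV. Qed.

(** On cycles [avoid v] is injective, and its image lies in the chains on the [m]-subsets of
    [V :\ v]. *)
Lemma dim_cycles_le X (j : int) m V v : v \in V -> j + 1 = m%:Z ->
  (forall s, s \in X -> s \subset V) ->
  (\dim (cycles K X j) <= 'C(#|V|.-1, m))%N.
Proof.
move=> vV jm XV.
have ker0 : (cycles K X j :&: lker (linfun (avoid v)) = 0)%VS.
  apply/eqP; rewrite -subv0; apply/subvP => c.
  rewrite memv_cap mem_cycles memv_ker lfunE memv0 /= => /andP[/andP[_ /eqP bc] /eqP ac].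
  have c0 s : v \notin s -> c s = 0.
    by move=> vs; move/ffunP/(_ s): ac; rewrite !ffunE vs mul1r.
  apply/eqP/ffunP => s; rewrite ffunE; case: (boolP (v \in s)) => [vs|/c0 //].
  (* Of the simplices one vertex larger than [s :\ v], only [s] contains [v], so this coefficient of
     [bd c] is [c s] up to sign. *)
  move/ffunP/(_ (s :\ v)): bc; rewrite bdE ffunE (bigD1 v) ?setD11 //=.
  rewrite big1 ?addr0 => [|u /andP[_ uv]]; last first.
    by rewrite c0 ?mulr0 // !inE eqxx eq_sym (negPf uv).
  by rewrite setD1K // => /eqP; rewrite mulf_eq0 signr_eq0 => /eqP.
rewrite -(limg_ker_dim (linfun (avoid v))) ker0 dimv0 add0n.
pose Y := [set s : {set 'I_n} | s \subset V :\ v & #|s| == m].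
rewrite -(card_draws_avoid m vV) -/Y.
have -> : Y = faces Y j.
  by apply/setP => s; rewrite (in_faces _ _ jm) !inE -andbA andbb.
rewrite -dim_chains; apply/dimvS/subvP => _ /memv_imgP[c cX ->].
move: cX; rewrite lfunE mem_cycles => /andP[/mem_chains cX _].
apply/mem_chains => s; rewrite (in_faces _ _ jm) !inE -andbA andbb ffunE.
case: (boolP (v \in s)) => vs; first by rewrite mul0r.
move=> H; rewrite cX ?mulr0 // (in_faces _ _ jm).
apply: contra H => /andP[sX ->]; rewrite andbT subsetD1 vs andbT; exact: XV.
Qed.

(** Under [avoid v], the boundaries of cones with apex [v] hit every [m]-subset of [V :\ v] up to
    sign. The cones themselves may lie outside [Y]; only their facets must belong to it. *)
Lemma dim_cycles_ge Y (j : int) m V : j + 1 = m%:Z ->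
  (#|V| = 0 -> m = 0)%N ->
  (forall s, s \subset V -> (#|s| <= m)%N -> s \in Y) ->
  ('C(#|V|.-1, m) <= \dim (cycles K Y j))%N.
Proof.
move=> jm V0 VY; case: (set_0Vmem V) => [VE|[v vV]].
  (* Without vertices the binomial coefficient is 1, and the empty simplex is a nonzero cycle of
     degree -1. *)
  have m0 := V0; rewrite VE cards0 in m0; rewrite VE cards0 m0 // bin0.
  rewrite lt0n dimv_eq0; apply/eqP => Z0.
  have : elem K set0 \in cycles K Y j.
    rewrite mem_cycles bd_elem big_set0 eqxx andbT; apply/mem_chains => s.
    rewrite (in_faces _ _ jm) m0 // cards_eq0 ffunE.
    by case: eqP => // ->; rewrite andbT VY ?sub0set ?cards0.
  rewrite Z0 memv0 => /eqP/ffunP/(_ set0); rewrite !ffunE eqxx => /eqP.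
  by rewrite oner_eq0.
rewrite -(card_draws_avoid m vV).
set S := finset _.
have SE : S = faces S j.
  by apply/setP => s; rewrite (in_faces _ _ jm) !inE -andbA andbb.
rewrite SE -dim_chains.
apply: (@leq_trans (\dim (linfun (avoid v) @: cycles K Y j))); last first.
  by rewrite -[leqRHS](limg_ker_dim (linfun (avoid v))) leq_addl.
rewrite /chains; apply/dimvS/span_subvP => _ /mapP[s + ->].
rewrite mem_enum -SE inE => /andP[sV /eqP sm].
have vs : v \notin s by move: sV; rewrite subsetD1 => /andP[].
apply/memv_imgP; exists ((-1) ^+ pos (v |: s) v *: bd (elem K (v |: s))).
  apply: rpredZ; rewrite mem_cycles bd_bd eqxx andbT bd_elem.
  apply: rpred_sum => u us; apply/rpredZ/memv_span/image_f.
  have um : #|(v |: s) :\ u| = m.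
    by have := cardsD1 u (v |: s); rewrite cardsU1 vs us sm => - [].
  rewrite (in_faces _ _ jm) um eqxx andbT VY ?um //.
  rewrite (subset_trans (subsetDl _ _)) // subUset sub1set vV.
  exact: subset_trans sV (subsetDl _ _).
rewrite lfunE /= linearZ /= bd_elem big_setU1 //= setU1K // linearD linearZ /=.
rewrite scalerDr scalerA -expr2 sqrr_sign scale1r.
(* The remaining facets of the cone contain [v], so [avoid v] kills them. *)
rewrite linear_sum /= big1 => [|u us].
  rewrite scaler0 addr0; apply/ffunP => t; rewrite !ffunE.
  by case: eqP => [->|]; rewrite ?vs ?mulr1 ?mulr0.
apply/ffunP => t; rewrite linearZ /= !ffunE.
case: (boolP (v \in t)) => vt; first by rewrite mul0r scaler0.
case: eqP => [tE|_]; last by rewrite mulr0 scaler0.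
suff : v \in t by rewrite (negPf vt).
by rewrite tE !inE eqxx andbT; apply: contraNneq vs => ->.
Qed.

(** * Projection onto the chains of a link *)

(** For disjoint [s] and [t], the sign of the permutation that sorts [s] followed by [t]. *)
Definition shuffle_sign (t s : {set 'I_n}) : K := \prod_(u in s) (-1) ^+ pos t u.

Lemma shuffle_sign_neq0 t s : shuffle_sign t s != 0.
Proof. by apply/prodf_neq0 => u _; rewrite signr_eq0. Qed.

(* The projection of the chains onto the star of [t], read as chains of the
   link; the sign makes it commute with the differential. *)
Definition to_link t c : chain K n :=
  [ffun s : {set 'I_n} => ([disjoint s & t])%:R * (shuffle_sign t s * c (s :|: t))].

Fact to_link_is_linear t : linear (to_link t).
Proof.
move=> a c c'; apply/ffunP => s; rewrite !ffunE !mulrDr; congr (_ + _).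
by rewrite (mulrCA _ a) (mulrCA _ a).
Qed.

HB.instance Definition _ t :=
  GRing.isLinear.Build K (chain K n) (chain K n) *:%R (to_link t)
    (to_link_is_linear t).

Lemma to_link_elem t s : [disjoint s & t] ->
  to_link t (elem K (s :|: t)) = shuffle_sign t s *: elem K s.
Proof.
move=> st; apply/ffunP => r; rewrite !ffunE.
case: (boolP [disjoint r & t]) => rt; last first.
  case: (r =P s) => [rs|_]; last by rewrite mul0r [RHS]mulr0.
  by rewrite rs st in rt.
rewrite mul1r; have -> : (r :|: t == s :|: t) = (r == s).
  apply/eqP/eqP => [E|-> //].
  have D (q : {set _}) : [disjoint q & t] -> (q :|: t) :\: t = q.
    by move=> /setDidPl qt; rewrite setDUl setDv setU0.
  by rewrite -(D r) // E D.
by case: eqP => [->|_] //; rewrite mulr0 [RHS]mulr0.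
Qed.

Lemma to_link_elem0 t s : ~~ (t \subset s) -> to_link t (elem K s) = 0.
Proof.
move=> ts; apply/ffunP => r; rewrite !ffunE.
case: eqP => [E|_]; last by rewrite !mulr0.
by rewrite -E subsetUr in ts.
Qed.

Lemma pos_setU s t u : [disjoint s & t] ->
  pos (s :|: t) u = (pos s u + pos t u)%N.
Proof.
move=> st; rewrite /pos -cardsUI.
have -> : [set w in s | (w < u)%N] :&: [set w in t | (w < u)%N] = set0.
  apply/setP => w; rewrite !inE; case: (boolP (w \in s)) => //= ws.
  by rewrite (disjointFr st ws) andbF.
rewrite cards0 addn0; congr #|pred_of_set _|; apply/setP => w.
by rewrite !inE andb_orl.
Qed.

(** Adding a vertex [u] to [s] shifts its position in [s :|: t] by [pos t u], which is exactly the
    factor that [u] contributes to the shuffle sign. *)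
Lemma to_link_bd t c : to_link t (bd c) = bd (to_link t c).
Proof.
apply/ffunP => s; rewrite bdE ffunE bdE.
case: (boolP [disjoint s & t]) => st; last first.
  rewrite mul0r big1 // => u us; rewrite ffunE.
  rewrite (_ : [disjoint _ & _] = false) ?mul0r ?mulr0 //; apply: negbTE.
  by apply: contra st; apply: disjointWl; apply: subsetUr.
rewrite mul1r mulr_sumr [RHS](bigID (mem t)) /= [X in _ = X + _]big1; last first.
  move=> u /andP[us ut]; rewrite ffunE.
  rewrite (_ : [disjoint _ & _] = false) ?mul0r ?mulr0 //;
    apply: negbTE.
  by apply/negP => /disjointFr/(_ (setU11 u s)); rewrite ut.
rewrite add0r; apply: eq_big => [u|u]; rewrite inE negb_or // => /andP[us ut].
have ust : [disjoint u |: s & t].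
  by rewrite -setI_eq0 setIUl setU_eq0 !setI_eq0 disjoints1 ut.
rewrite ffunE ust mul1r setUA pos_setU // exprD /shuffle_sign big_setU1 //=.
by ring.
Qed.

(** A face [s] of the link lifts to the face [s :|: t] of [X], and projection commutes with the
    differential. *)
Lemma boundaries_link X t (i j : int) : i = j + #|t|%:Z ->
  (boundaries K (link X t) j <= linfun (to_link t) @: boundaries K X i)%VS.
Proof.
move=> ij; apply/subvP => _ /memv_imgP[c cX ->].
rewrite lfunE /=; have /mem_chains c0 := cX.
rewrite [c]chain_sum_elem linear_sum; apply: rpred_sum => s _.
case: (boolP (s \in faces (link X t) (j + 1))) => [|/c0 ->]; last first.
  by rewrite scale0r linear0 mem0v.
rewrite !inE setI_eq0 => /andP[/and3P[sX stX st] /eqP sj].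
rewrite linearZ /=; apply: rpredZ; apply/memv_imgP.
exists (bd ((shuffle_sign t s)^-1 *: elem K (s :|: t))).
  rewrite -[bd _]lfunE; apply/memv_img/rpredZ/memv_span/image_f.
  rewrite inE stX /Defs.dim cardsU; move: (st); rewrite -setI_eq0 => /eqP ->.
  rewrite cards0 subn0; apply/eqP; rewrite ij addrAC -sj /Defs.dim PoszD; ring.
rewrite lfunE /= to_link_bd linearZ /= to_link_elem // scalerA mulVf ?scale1r //.
exact: shuffle_sign_neq0.
Qed.

End Chains.

(** * A basis of the boundaries indexed by faces *)

(** Selecting indices rather than vectors lets a basis of boundaries remember its simplices. *)
Lemma extract_free (F : fieldType) (vT : vectType F) (T : eqType) (f : T -> vT)
    (s : seq T) :
  exists2 r, subseq r s &
    free (map f r) /\ (<<map f r>> = <<map f s>>)%VS.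
Proof.
elim: s => [|x s [r rs [fr sp]]]; first by exists [::]; rewrite ?nil_free.
case: (boolP (f x \in <<map f s>>%VS)) => fx.
  exists r; first exact: subseq_trans rs (subseq_cons _ _).
  split=> //; rewrite /= span_cons -sp; apply/esym/addv_idPr.
  by rewrite -memvE sp.
exists (x :: r); first by rewrite /= eqxx.
by split; rewrite /= ?free_cons ?sp ?fx // !span_cons sp.
Qed.

(** One [A] serves every [t], so the estimates can be summed over [t]. *)
Lemma exists_basis_faces (K : fieldType) n (X : {set {set 'I_n}}) (i : int) :
  exists2 A : {set {set 'I_n}}, A \subset faces X (i + 1) &
    #|A| = \dim (boundaries K X i) /\
    forall (t : {set 'I_n}) (j : int), i = j + #|t|%:Z ->
      (\dim (boundaries K (link X t) j) <= #|[set s in A | t \subset s]|)%N.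
Proof.
have [r rs [fr sp]] := extract_free (fun s => bd (elem K s)) (enum (faces X (i + 1))).
have rU : uniq r := subseq_uniq rs (enum_uniq _).
have spB : (<<[seq bd (elem K s) | s <- r]>> = boundaries K X i)%VS.
  rewrite sp /boundaries /chains limg_span -map_comp; congr <<_>>%VS.
  by apply: eq_map => s; rewrite /= lfunE.
exists [set s in r].
  by apply/subsetP => s; rewrite inE => /(mem_subseq rs); rewrite mem_enum.
split.
  rewrite -spB; move: fr => /eqP ->; rewrite size_map -(card_uniqP rU).
  by apply: eq_card => s; rewrite inE.
move=> t j ij; apply: leq_trans (dimvS (boundaries_link K X ij)) _.
rewrite -spB limg_span.
set E := finset (fun s => (s \in _) && _).
apply: (@leq_trans (\dim <<[seq to_link t (bd (elem K s)) | s <- enum E]>>)); last first.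
  by apply: leq_trans (dim_span _) _; rewrite size_map -cardE.
apply/dimvS/span_subvP => _ /mapP[_ /mapP[s sr ->] ->]; rewrite lfunE /=.
case: (boolP (t \subset s)) => ts; last first.
  by rewrite to_link_bd to_link_elem0 // linear0 mem0v.
by apply/memv_span/map_f; rewrite mem_enum !inE sr.
Qed.

(** * Double counting and binomial identities *)

Lemma sum_card_supersets n (A : {set {set 'I_n}}) p m :
  (forall s, s \in A -> #|s| = p) ->
  (\sum_(t : {set 'I_n} | #|t| == m) #|[set s in A | t \subset s]|
    = #|A| * 'C(p, m))%N.
Proof.
move=> Ap; under eq_bigr do rewrite -sum1dep_card.
rewrite (exchange_big_dep (mem A)) /= => [|t s _ /andP[] //].
rewrite -sum_nat_const; apply: eq_bigr => s sA.
rewrite -(Ap s sA) -cards_draws -sum1dep_card; apply: eq_bigl => t.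
by rewrite sA andbC.
Qed.

Lemma binz_nat (a b : nat) : binz a%:Z b = 'C(a, b)%:R.
Proof.
have fb : (b`!)%:R != 0 :> rat by rewrite pnatr_eq0 -lt0n fact_gt0.
apply: (canLR (mulfK fb)); rewrite -natrM bin_ffact.
elim: b {fb} => [|b IH]; first by rewrite big_ord0.
rewrite big_ord_recr /= IH ffactnSr natrM.
case: (leqP b a) => ba; first by rewrite subzn // pmulrn.
by rewrite ffact_small // !mul0r.
Qed.

(** Pascal's rule, except when [l = N]: then [k = l + 1], the upper argument is -1, and both sides
    equal -1. *)
Lemma binz_pascal (N k l : nat) : (l < k)%N -> (l <= N)%N -> (k <= N.+1)%N ->
  binz (N%:Z - l%:Z - 1) (k - l) =
    'C(N - l, k - l)%:R - 'C((N - l).-1, (k - l).-1)%:R.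
Proof.
move=> lk; rewrite leq_eqVlt => /orP[/eqP <-|lN] kN.
  have -> : k = l.+1 by apply/eqP; rewrite eqn_leq kN.
  by rewrite subSnn subnn subrr /binz big_ord1 divr1.
have -> : N%:Z - l%:Z - 1 = (N - l).-1%:Z by lia.
rewrite binz_nat; case: (N - l)%N (k - l)%N (subn_gt0 l k) (subn_gt0 l N) => [|a] [|b];
  rewrite ?lk ?lN // => _ _.
by rewrite binS natrD addrK.
Qed.

(** Both sides count the pairs of an [l]-set inside a [k]-set. *)
Lemma bin_mul_sub (N k l : nat) : (l <= k)%N ->
  ('C(N, k) * 'C(k, l) = 'C(N, l) * 'C(N - l, k - l))%N.
Proof.
move=> lk; case: (leqP k N) => kN; last first.
  rewrite (bin_small kN) mul0n; case: (leqP l N) => lN; last by rewrite (bin_small lN).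
  by rewrite (_ : 'C(N - l, k - l) = 0%N) ?muln0 // bin_small //; lia.
apply/eqP; rewrite -(eqn_pmul2r (_ : 0 < l`! * (k - l)`! * (N - k)`!)%N); last first.
  by rewrite !muln_gt0 !fact_gt0.
have E1 := bin_fact kN; have E2 := bin_fact lk.
have E3 := bin_fact (leq_trans lk kN).
have lN : (k - l <= N - l)%N by lia.
have E4 := bin_fact lN; have E5 : (N - l - (k - l) = N - k)%N by lia.
rewrite E5 in E4; apply/eqP; transitivity N`!.
  by rewrite -E1 -E2; ring.
by rewrite -E3 -E4; ring.
Qed.

(** Clearing the denominator exhibits the bound as the cycle dimension minus the contribution of the
    double count. *)
Lemma boundE (N k l : nat) : (l < k)%N -> (k <= N.+1)%N ->
  bound N.+1 k l * 'C(k.+1, l.+1)%:R =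
    ('C(N, k) * 'C(k.+1, l.+1))%:R
    - ('C(N.+1, l.+1) * 'C((N - l).-1, (k - l).-1))%:R.
Proof.
move=> lk kN; have lN : (l <= N)%N by lia.
have -> : bound N.+1 k l =
    binz N%:Z l * binz (N%:Z - l%:Z - 1) (k - l) / binz k.+1%:Z l.+1.
  by rewrite /bound; congr (binz _ _ * binz _ _ / binz _ _); lia.
rewrite !binz_nat binz_pascal // divfK; last first.
  by rewrite pnatr_eq0 -lt0n bin_gt0 ltnS ltnW.
have e1 := bin_mul_sub N (ltnW lk); have e2 := bin_mul_sub N lk.
rewrite [in RHS]binS mulnDr e1 e2 [in 'C(N.+1, _)]binS.
have -> : ((N - l).-1 = N - l.+1)%N by lia.
have -> : ((k - l).-1 = k - l.+1)%N by lia.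
by rewrite !natrM !natrD !natrM; ring.
Qed.

Theorem corollary3 (K : fieldType) (l k n : nat) (X : {set {set 'I_n}})
    (lk : (l < k)%N) (kn : (k <= n)%N) (HX : is_complex X)
    (Xskel : skeleton (full_simplex n) (k%:Z - 1) \subset X)
    (Xsub : X \subset full_simplex n)
    (Hlambda : lambda K X l%:Z (k%:Z - l%:Z - 2) = 0%N) :
  (betti K X (k%:Z - 1))%:R <= bound n k l.
Proof.
case: n X kn HX Xskel Xsub Hlambda => [|N] X kn HX Xskel _ Hlambda; first by lia.
have Xk (s : {set 'I_N.+1}) : (#|s| <= k)%N -> s \in X.
  move=> sk; apply: (subsetP Xskel); rewrite !inE subsetT /= /Defs.dim; lia.
have [A AX [cardA Alink]] := exists_basis_faces K X (k%:Z - 1).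
have Ak s : s \in A -> #|s| = k.+1.
  move=> /(subsetP AX); rewrite (in_faces _ _ (m := k.+1)); last by lia.
  by case/andP => _ /eqP.
have linkP (t : {set 'I_N.+1}) : #|t| == l.+1 ->
    ('C((N - l).-1, (k - l).-1) <= #|[set s in A | t \subset s]|)%N.
  move=> /eqP tl.
  apply: leq_trans (Alink t (k%:Z - l%:Z - 2) _); last by rewrite tl; lia.
  have tX : t \in faces X l%:Z.
    by rewrite (in_faces _ _ (m := l.+1)) ?tl ?eqxx ?Xk ?tl //; lia.
  apply: (@leq_trans (\dim (cycles K (link X t) (k%:Z - l%:Z - 2)))).
    have ct : (#|~: t| = N - l)%N by have := cardsC t; rewrite card_ord tl; lia.
    rewrite -ct; apply: dim_cycles_ge; rewrite ?ct; [lia|lia|].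
    (* Here [s :|: t] has at most [k] vertices, so it lies in the full skeleton. *)
    move=> s; rewrite -disjoints_subset => st sm.
    rewrite inE setI_eq0 st andbT !Xk //; first by lia.
    by rewrite cardsU tl; lia.
  (* Each summand vanishes; as [betti] is a truncated difference, this bounds the cycles by the
     boundaries in dimension. *)
  move: Hlambda => /eqP; rewrite sum_nat_eq0 => /forall_inP/(_ t tX).
  by rewrite subn_eq0.
have countA : ('C(N.+1, l.+1) * 'C((N - l).-1, (k - l).-1)
    <= #|A| * 'C(k.+1, l.+1))%N.
  rewrite -(sum_card_supersets l.+1 Ak) -[X in 'C(X, _)]card_ord -card_draws.
  by rewrite -sum_nat_const; under eq_bigl do rewrite inE; apply: leq_sum.
have dimZ : (\dim (cycles K X (k%:Z - 1)) <= 'C(N, k))%N.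
  have := @dim_cycles_le K _ X (k%:Z - 1) k setT ord0.
  by rewrite cardsT card_ord; apply => [||s _]; rewrite ?inE ?subsetT //; lia.
(* Boundaries being cycles, the truncated subtraction in [betti] is exact. *)
have bA : (betti K X (k%:Z - 1) + #|A| <= 'C(N, k))%N.
  by rewrite cardA /betti subnK // dimvS // boundaries_sub_cycles.
have C0 : (0 < 'C(k.+1, l.+1))%N by rewrite bin_gt0 ltnS ltnW.
rewrite -(ler_pM2r (_ : 0 < 'C(k.+1, l.+1)%:R)) ?ltr0n // boundE //.
rewrite lerBrDr -natrM -natrD ler_nat.
apply: leq_trans (leq_add (leqnn _) countA) _.
by rewrite -mulnDl leq_mul2r bA orbT.
Qed.
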